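(* Let $(\mathbf A,\mathbf n)\in\mathcal{INCA}$, $1=\mathbf n(e)$, $\imath=\mathbf n(\sim e)$, and let $F_A=\{\mathbf n(x)\oplus\mathbf n(\sim x):x\in A\}$. Then $F_A$ is a lattice filter of $\mathbf L_{\mathbf A}$ and $$\mathbf A\cong\mathbf{Tw}(\mathbf L_{\mathbf A},\imath,F_A).$$
   Context: A commutative residuated lattice is an algebra $(A,\wedge,\vee,\cdot,\to,e)$ such that $(A,\wedge,\vee)$ is a lattice, $(A,\cdot,e)$ is a commutative monoid, and $xy\le z$ iff $y\le x\to z$. A commutative involutive residuated lattice has in addition a unary operation $\sim$ satisfying $\sim\sim x=x$ and $x\to\sim y=y\to\sim x$. A Nelson conucleus on a commutative residuated lattice $\mathbf A$ is a map $\mathbf n:A\to A$ such that $\mathbf n(x)\le x$; $\mathbf n(\mathbf n(x))=\mathbf n(x)$; $x\le y$ implies $\mathbf n(x)\le\mathbf n(y)$; $\mathbf n(e)\mathbf n(x)=\mathbf n(x)$; $\mathbf n(x\vee y)=\mathbf n(x)\vee\mathbf n(y)$; $\mathbf n(xy)=\mathbf n(x)\mathbf n(y)$; and $xy\le\mathbf n(x)y\vee x\mathbf n(y)$. $\mathcal{INCA}$ is the class of $(\mathbf A,\mathbf n)$ where $\mathbf A$ is a commutative involutive residuated lattice with a constant $\bot$ for its bottom element, $\mathbf n$ is a Nelson conucleus on $\mathbf A$, and (IT1) $\mathbf n(\mathbf n(\mathbf n(x)\to\bot)\to\bot)=\mathbf n(x)$ for all $x$. For $(\mathbf A,\mathbf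 n)\in\mathcal{INCA}$, $\mathbf L_{\mathbf A}$ is the residuated lattice $\mathbf A_{\mathbf n}=(\mathbf n[A],\wedge_{\mathbf n},\vee,\cdot,\to_{\mathbf n},e)$, where $x\wedge_{\mathbf n}y=\mathbf n(x\wedge y)$ and $x\to_{\mathbf n}y=\mathbf n(x\to y)$, together with $0=\mathbf n(\bot)$ as bottom and negation constant and $1=\mathbf n(e)=e$ as unit. For $a,b\in\mathbf n[A]$ put $\neg_{\mathbf n}a=a\to_{\mathbf n}0$ and $a\oplus b=\neg_{\mathbf n}a\to_{\mathbf n}b$. (By (IT1), $\neg_{\mathbf n}\neg_{\mathbf n}a=a$.) For $\imath\in L_A$ and a lattice filter $F$ of $\mathbf L_{\mathbf A}$ containing $1\oplus\imath$, $\mathbf{Tw}(\mathbf L_{\mathbf A},\imath,F)$ is the algebra with universe $\{(a,b)\in L_A\times L_A: ab\le\imath,\ a\oplus b\in F\}$ and operations (all computed with the operations of $\mathbf L_{\mathbf A}$) $(a,b)\wedge(a',b')=(a\wedge_{\mathbf n}a',b\vee b')$, $(a,b)\vee(a',b')=(a\vee a',b\wedge_{\mathbf n}b')$, $\sim(a,b)=(b,a)$, $(a,b)\cdot(a',b')=(aa',(a\to_{\mathbf n}b')\wedge_{\mathbf n}(a'\to_{\mathbf n}b))$, $(a,b)\to(a',b')=((a\to_{\mathbf n}a')\wedge_{\mathbf n}(b'\to_{\mathbf n}b),ab')$, and identity $(1,\imath)$; it is a commutative involutive residuated lattice. The isomorphism is one of involutive residuated lattices. *)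

(* Defs.v *)
From HB Require Import structures.
From mathcomp Require Import all_boot all_order.
From mathcomp Require Import boolp classical_sets.

Set Implicit Arguments.
Unset Strict Implicit.
Unset Printing Implicit Defensive.

Import Order.Theory.
Local Open Scope group_scope.
Local Open Scope order_scope.

HB.mixin Record isCommResiduated (d : Order.disp_t) A
    of Order.Lattice d A & Monoid A := {
  crl_mulC : commutative (@mul A);
  rimp : A -> A -> A;
  rimpP : forall x y z : A, ((x * y)%g <= z) = (y <= rimp x z)
}.

#[short(type="crlType")]
HB.structure Definition CRL (d : Order.disp_t) :=
  {A of Order.Lattice d A & Monoid A & isCommResiduated d A}.

Notation "x \to y" := (rimp x y)
  (at level 55, right associativity) : order_scope.

#[short(type="bcrlType")]
HB.structure Definition BCRL (d : Order.disp_t) :=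
  {L of CRL d L & Order.BLattice d L}.

HB.mixin Record isInvolutive (d : Order.disp_t) A of CRL d A := {
  sim : A -> A;
  simK : involutive sim;
  rimp_simC : forall x y : A, x \to sim y = y \to sim x
}.

#[short(type="cirlType")]
HB.structure Definition CIRL (d : Order.disp_t) :=
  {A of CRL d A & isInvolutive d A}.

Notation "\sim x" := (sim x) (at level 35, right associativity) : order_scope.

#[short(type="bcirlType")]
HB.structure Definition BCIRL (d : Order.disp_t) :=
  {A of CIRL d A & Order.BLattice d A}.

Definition rneg d (L : bcrlType d) (a : L) : L := a \to \bot.
Definition oplus d (L : bcrlType d) (a b : L) : L := rneg a \to b.

Notation "a \oplus b" := (oplus a b)
  (at level 50, left associativity) : order_scope.

HB.mixin Record isBotInvolutive (d : Order.disp_t) L of BCRL d L := {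
  rnegK : involutive (@rneg d L)
}.

(* The double negation law on L is what makes the twist universe below closed *)
(* under multiplication and implication.                                      *)
#[short(type="dncrlType")]
HB.structure Definition DNCRL (d : Order.disp_t) :=
  {L of BCRL d L & isBotInvolutive d L}.

Record cirl_iso d d' (A : cirlType d) (B : cirlType d') (f : A -> B) : Prop := {
  iso_bij  : bijective f;
  iso_meet : {morph f : x y / x `&` y >-> x `&` y};
  iso_join : {morph f : x y / x `|` y >-> x `|` y};
  iso_mul  : {morph f : x y / (x * y)%g >-> (x * y)%g};
  iso_rimp : {morph f : x y / x \to y >-> x \to y};
  iso_sim  : {morph f : x / \sim x >-> \sim x};
  iso_one  : f 1%g = 1%g
}.

Definition cirl_isomorphic d d' (A : cirlType d) (B : cirlType d') : Prop :=
  exists f : A -> B, cirl_iso f.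

Record lattice_filter d (L : latticeType d) (F : set L) : Prop := {
  filter_nonempty : (F !=set0)%classic;
  filter_up : forall x y : L, F x -> x <= y -> F y;
  filter_meet : forall x y : L, F x -> F y -> F (x `&` y)
}.

Record nelson_conucleus d (A : crlType d) (n : A -> A) : Prop := {
  ncn_le     : forall x, n x <= x;
  ncn_idem   : forall x, n (n x) = n x;
  ncn_mono   : forall x y, x <= y -> n x <= n y;
  ncn_one    : forall x, (n 1 * n x)%g = n x;
  ncn_join   : forall x y, n (x `|` y) = n x `|` n y;
  ncn_mul    : forall x y, n (x * y)%g = (n x * n y)%g;
  ncn_nelson : forall x y, (x * y)%g <= (n x * y)%g `|` (x * n y)%g
}.

Record inca d (A : bcirlType d) (n : A -> A) : Prop := {
  inca_conucleus :> nelson_conucleus n;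
  inca_IT1 : forall x, n (n (n x \to \bot) \to \bot) = n x
}.

Section CRLTheory.
Variables (d : Order.disp_t) (A : crlType d).
Implicit Types x y z : A.

Lemma crl_mulCA x y z : (x * (y * z) = y * (x * z))%g.
Proof. by rewrite !mulgA (crl_mulC x y). Qed.

Lemma rimpP' x y z : ((x * y)%g <= z) = (x <= y \to z).
Proof. by rewrite crl_mulC rimpP. Qed.

Lemma mul_rimp x y : (x * (x \to y))%g <= y.
Proof. by rewrite rimpP. Qed.

Lemma crl_mulS x y z : y <= z -> (x * y)%g <= (x * z)%g.
Proof. by move=> yz; rewrite rimpP (le_trans yz) // -rimpP. Qed.

Lemma crl_mulSl x y z : y <= z -> (y * x)%g <= (z * x)%g.
Proof. by move=> yz; rewrite !(crl_mulC _ x) crl_mulS. Qed.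

Lemma rimpS x y z : y <= z -> x \to y <= x \to z.
Proof. by move=> yz; rewrite -rimpP (le_trans (mul_rimp x y)). Qed.

Lemma rimpSl x y z : y <= z -> z \to x <= y \to x.
Proof.
by move=> yz; rewrite -rimpP (le_trans (crl_mulSl _ yz)) // mul_rimp.
Qed.

Lemma rimpM x y z : (x * y)%g \to z = x \to (y \to z).
Proof.
have H w : (w <= (x * y)%g \to z) = (w <= x \to (y \to z)).
  by rewrite -!rimpP mulgA (crl_mulC x).
by apply/le_anti; rewrite -H lexx H lexx.
Qed.

Lemma rimpI x y z : x \to (y `&` z) = (x \to y) `&` (x \to z).
Proof.
have H w : (w <= x \to (y `&` z)) = (w <= (x \to y) `&` (x \to z)).
  by rewrite lexI -!rimpP lexI.
by apply/le_anti; rewrite -H lexx H lexx.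
Qed.

Lemma rimp_rimpC x y z : x \to (y \to z) = y \to (x \to z).
Proof. by rewrite -!rimpM crl_mulC. Qed.

End CRLTheory.

(* The algebra L_A. The proof hn does not affect the carrier; it is a         *)
(* parameter so that the algebraic structure can be attached to the type.     *)
Record conucleus_image d (A : bcirlType d) (n : A -> A) (hn : inca n) : Type :=
  ConucleusImage { im_val : A; _ : im_val \in range n }.

Section ConucleusImage.
Variables (d : Order.disp_t) (A : bcirlType d) (n : A -> A) (hn : inca n).

HB.instance Definition _ := [isSub for @im_val d A n hn].
HB.instance Definition _ := [Choice of conucleus_image hn by <:].

Local Notation L := (conucleus_image hn).
Implicit Types a b c : L.

Lemma im_of_subproof (x : A) : n x \in range n.
Proof. by apply/mem_set; exists x. Qed.

Definition im_of (x : A) : L := @ConucleusImage d A n hn (n x) (im_of_subproof x).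

Lemma im_ofE x : val (im_of x) = n x. Proof. by []. Qed.

Lemma im_fix a : n (val a) = val a.
Proof. by case: a => x /= /set_mem [y _ <-]; apply: (ncn_idem hn). Qed.

Lemma im_join_subproof a b : val a `|` val b \in range n.
Proof.
by apply/mem_set; exists (val a `|` val b) => //; rewrite (ncn_join hn) !im_fix.
Qed.

Lemma im_mul_subproof a b : (val a * val b)%g \in range n.
Proof.
by apply/mem_set; exists (val a * val b)%g => //; rewrite (ncn_mul hn) !im_fix.
Qed.

Definition im_meet a b : L := im_of (val a `&` val b).
Definition im_join a b : L := @ConucleusImage d A n hn (val a `|` val b) (im_join_subproof a b).
Definition im_mul a b : L := @ConucleusImage d A n hn (val a * val b)%g (im_mul_subproof a b).
Definition im_rimp a b : L := im_of (val a \to val b).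
Definition im_one : L := im_of 1%g.
Definition im_bot : L := im_of \bot.

HB.instance Definition _ := [SubChoice_isSubPOrder of L by <: with d].

Lemma im_leE a b : (a <= b) = (val a <= val b).
Proof. by []. Qed.

Lemma im_le_of a x : (val a <= n x) = (val a <= x).
Proof.
apply/idP/idP => [h|h]; first exact: le_trans h (ncn_le hn x).
by rewrite -im_fix; apply: (ncn_mono hn).
Qed.

Lemma im_lexI a b c : (a <= im_meet b c) = (a <= b) && (a <= c).
Proof. by rewrite !im_leE im_ofE im_le_of lexI. Qed.

Lemma im_leUx a b c : (im_join a b <= c) = (a <= c) && (b <= c).
Proof. by rewrite !im_leE leUx. Qed.

HB.instance Definition _ := Order.POrder_isMeetSemilattice.Build d L im_lexI.
HB.instance Definition _ := Order.POrder_isJoinSemilattice.Build d L im_leUx.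

Lemma im_le0x a : im_bot <= a.
Proof. by rewrite im_leE (le_trans (ncn_le hn _)) // le0x. Qed.

HB.instance Definition _ := Order.hasBottom.Build d L im_le0x.

Lemma im_mulA : associative im_mul.
Proof. by move=> a b c; apply: val_inj; apply: mulgA. Qed.

Lemma im_mulC : commutative im_mul.
Proof. by move=> a b; apply: val_inj; apply: crl_mulC. Qed.

Lemma im_mul1 : left_id im_one im_mul.
Proof.
by move=> a; apply: val_inj; rewrite /= -[in LHS]im_fix (ncn_one hn) im_fix.
Qed.

Lemma im_mul1r : right_id im_one im_mul.
Proof. by move=> a; rewrite im_mulC im_mul1. Qed.

HB.instance Definition _ := isMonoid.Build L im_mulA im_mul1 im_mul1r.

Lemma im_rimpP a b c : (im_mul a b <= c) = (b <= im_rimp a c).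
Proof. by rewrite !im_leE im_ofE im_le_of -rimpP. Qed.

HB.instance Definition _ := isCommResiduated.Build d L im_mulC im_rimpP.

Lemma im_rnegK : involutive (@rneg d L).
Proof.
move=> a; apply: val_inj => /=.
have bot0 : n \bot = \bot :> A by apply/le_anti; rewrite (ncn_le hn) le0x.
by rewrite bot0 -[in LHS]im_fix (inca_IT1 hn) im_fix.
Qed.

HB.instance Definition _ := isBotInvolutive.Build d L im_rnegK.

End ConucleusImage.

Definition twist_set d (L : dncrlType d) (i : L) (F : set L) : set (L * L) :=
  [set p : L * L | (p.1 * p.2)%g <= i /\ F (p.1 \oplus p.2)]%classic.

(* Tw(L, i, F); as above, hF and hi only serve to attach the structure.       *)
Record twist d (L : dncrlType d) (i : L) (F : set L)
    (hF : lattice_filter F) (hi : F (1%g \oplus i)) : Type :=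
  Twist { tw_val : L * L; _ : tw_val \in twist_set i F }.
Arguments twist {d} L i F hF hi.

Section OplusTheory.
Variables (d : Order.disp_t) (L : dncrlType d).
Implicit Types a b c : L.

Lemma le_rneg a b : (a <= rneg b) = ((b * a)%g <= \bot).
Proof. by rewrite rimpP. Qed.

Lemma rneg_rimpC a b : rneg a \to b = rneg b \to a.
Proof.
suff H (x y : L) : rneg x \to y <= rneg y \to x by apply/le_anti; rewrite !H.
rewrite -rimpP -[leRHS]rnegK le_rneg crl_mulCA.
by rewrite (le_trans (crl_mulS _ (mul_rimp _ _))) // crl_mulC mul_rimp.
Qed.

Lemma oplusC a b : a \oplus b = b \oplus a.
Proof. exact: rneg_rimpC. Qed.

Lemma oplusS a b a' b' : a <= a' -> b <= b' -> a \oplus b <= a' \oplus b'.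
Proof.
move=> aa bb; apply: le_trans (rimpS _ bb) _.
by apply: rimpSl; apply: rimpSl.
Qed.

Lemma oplus_lexI a b c : (a \oplus b) `&` (a \oplus c) <= a \oplus (b `&` c).
Proof.
by rewrite -rimpP lexI !rimpP leIl leIr.
Qed.

Lemma oplus_mul_rimp a a' b : a' \oplus b <= (a * a')%g \oplus (a \to b).
Proof.
rewrite /oplus -!rimpP mulgA.
rewrite (le_trans (crl_mulSl _ _) (mul_rimp (rneg a') _)) //.
by rewrite /rneg -rimpP mulgA (crl_mulC a') mul_rimp.
Qed.

End OplusTheory.

Section Twist.
Variables (d : Order.disp_t) (L : dncrlType d) (i : L) (F : set L).
Variables (hF : lattice_filter F) (hi : F (1%g \oplus i)).

HB.instance Definition _ := [isSub for @tw_val d L i F hF hi].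
HB.instance Definition _ := [Choice of twist L i F hF hi by <:].

Local Notation T := (twist L i F hF hi).
Implicit Types p q r : T.

Local Notation fst p := (val p).1.
Local Notation snd p := (val p).2.

Definition tw_pair (a b : L) (h : twist_set i F (a, b)) : T :=
  @Twist d L i F hF hi (a, b) (mem_set h).

Lemma tw_inj p q : fst p = fst q -> snd p = snd q -> p = q.
Proof.
move=> h1 h2; apply: val_inj.
by rewrite (surjective_pairing (val p)) h1 h2 -surjective_pairing.
Qed.

Lemma twP p : twist_set i F (fst p, snd p).
Proof. by case: p => -[a b] h; exact: set_mem h. Qed.

Lemma tw_mul_le p : (fst p * snd p)%g <= i. Proof. by case: (twP p). Qed.
Lemma tw_oplus p : F (fst p \oplus snd p). Proof. by case: (twP p). Qed.

Lemma tw_sim_subproof p : twist_set i F (snd p, fst p).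
Proof. by split; rewrite /= ?(crl_mulC (snd p)) 1?oplusC; case: (twP p). Qed.

Lemma tw_meet_subproof p q : twist_set i F (fst p `&` fst q, snd p `|` snd q).
Proof.
split=> /=.
  rewrite rimpP leUx -!rimpP.
  rewrite (le_trans (crl_mulSl _ (leIl _ _)) (tw_mul_le p)).
  by rewrite (le_trans (crl_mulSl _ (leIr _ _)) (tw_mul_le q)).
apply: filter_up (filter_meet hF (tw_oplus p) (tw_oplus q)) _ => //.
rewrite [leRHS]oplusC; apply: le_trans _ (oplus_lexI _ _ _).
by apply: leI2; rewrite oplusC; apply: oplusS; rewrite ?leUl ?leUr.
Qed.

Lemma tw_join_subproof p q : twist_set i F (fst p `|` fst q, snd p `&` snd q).
Proof.
exact: (tw_sim_subproof
  (tw_pair (tw_meet_subproof (tw_pair (tw_sim_subproof p))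
                             (tw_pair (tw_sim_subproof q))))).
Qed.

Lemma tw_mul_subproof p q : twist_set i F
  ((fst p * fst q)%g, (fst p \to snd q) `&` (fst q \to snd p)).
Proof.
split=> /=.
  rewrite (le_trans (crl_mulS _ (leIl _ _))) // (crl_mulC (fst p)) -mulgA.
  by rewrite (le_trans (crl_mulS _ (mul_rimp _ _))) // tw_mul_le.
apply: filter_up (filter_meet hF (tw_oplus p) (tw_oplus q)) _ => //.
apply: le_trans _ (oplus_lexI _ _ _).
by rewrite lexI leIxr ?oplus_mul_rimp // leIxl // crl_mulC oplus_mul_rimp.
Qed.

Lemma tw_rimp_subproof p q : twist_set i F
  ((fst p \to fst q) `&` (snd q \to snd p), (fst p * snd q)%g).
Proof.
exact: (tw_sim_subproof
  (tw_pair (tw_mul_subproof p (tw_pair (tw_sim_subproof q))))).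
Qed.

Lemma tw_one_subproof : twist_set i F (1%g, i).
Proof. by split=> //=; rewrite mul1g. Qed.

Definition tw_meet p q : T := tw_pair (tw_meet_subproof p q).
Definition tw_join p q : T := tw_pair (tw_join_subproof p q).
Definition tw_sim p : T := tw_pair (tw_sim_subproof p).
Definition tw_mul p q : T := tw_pair (tw_mul_subproof p q).
Definition tw_rimp p q : T := tw_pair (tw_rimp_subproof p q).
Definition tw_one : T := tw_pair tw_one_subproof.

Definition tw_le p q := (fst p <= fst q) && (snd q <= snd p).

Lemma tw_le_refl : reflexive tw_le.
Proof. by move=> p; rewrite /tw_le !lexx. Qed.

Lemma tw_le_anti : antisymmetric tw_le.
Proof.
move=> p q /andP[/andP[h1 h2] /andP[h3 h4]].
by apply: tw_inj; apply: le_anti; rewrite ?h1 ?h2 ?h3 ?h4.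
Qed.

Lemma tw_le_trans : transitive tw_le.
Proof.
move=> q p r /andP[h1 h2] /andP[h3 h4].
by rewrite /tw_le (le_trans h1 h3) (le_trans h4 h2).
Qed.

HB.instance Definition _ :=
  Order.Le_isPOrder.Build d T tw_le_refl tw_le_anti tw_le_trans.

Lemma tw_leE p q : (p <= q) = (fst p <= fst q) && (snd q <= snd p).
Proof. by []. Qed.

Lemma tw_lexI p q r : (p <= tw_meet q r) = (p <= q) && (p <= r).
Proof. by rewrite !tw_leE /= lexI leUx andbACA. Qed.

Lemma tw_leUx p q r : (tw_join p q <= r) = (p <= r) && (q <= r).
Proof. by rewrite !tw_leE /= lexI leUx andbACA. Qed.

HB.instance Definition _ := Order.POrder_isMeetSemilattice.Build d T tw_lexI.
HB.instance Definition _ := Order.POrder_isJoinSemilattice.Build d T tw_leUx.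

Lemma tw_mulC : commutative tw_mul.
Proof.
by move=> p q; apply: tw_inj; [exact: crl_mulC | exact: meetC].
Qed.

Lemma tw_rimpP p q r : (tw_mul p q <= r) = (q <= tw_rimp p r).
Proof.
rewrite !tw_leE /= !lexI -!rimpP -andbA; congr (_ && _).
by rewrite andbC [in LHS](crl_mulC (fst q)) rimpP'.
Qed.

Lemma tw_mulA : associative tw_mul.
Proof.
move=> p q r; apply: tw_inj => /=; first exact: mulgA.
rewrite !rimpI !rimpM -meetA; congr (_ `&` (_ `&` _)); exact: rimp_rimpC.
Qed.

Lemma tw_mul1 : left_id tw_one tw_mul.
Proof.
have rimp1 (x : L) : 1%g \to x = x.
  have H w : (w <= 1%g \to x) = (w <= x) by rewrite -rimpP mul1g.
  by apply/le_anti; rewrite -H lexx H lexx.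
move=> p; apply: tw_inj; rewrite /= ?mul1g //; apply/eqP.
by rewrite rimp1 eq_meetl -rimpP tw_mul_le.
Qed.

Lemma tw_mul1r : right_id tw_one tw_mul.
Proof. by move=> p; rewrite tw_mulC tw_mul1. Qed.

HB.instance Definition _ := isMonoid.Build T tw_mulA tw_mul1 tw_mul1r.
HB.instance Definition _ := isCommResiduated.Build d T tw_mulC tw_rimpP.

Lemma tw_simK : involutive tw_sim.
Proof. by move=> p; apply: tw_inj. Qed.

Lemma tw_rimp_simC p q : p \to tw_sim q = q \to tw_sim p.
Proof.
by apply: tw_inj; [exact: meetC | exact: crl_mulC].
Qed.

HB.instance Definition _ := isInvolutive.Build d T tw_simK tw_rimp_simC.

End Twist.

Section FA.
Variables (d : Order.disp_t) (A : bcirlType d) (n : A -> A) (hn : inca n).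

Definition iotaA : conucleus_image hn := im_of hn (\sim 1%g).

Definition FA : set (conucleus_image hn) :=
  range (fun x : A => im_of hn x \oplus im_of hn (\sim x)).
Arguments FA : clear implicits.

Lemma one_oplus_iotaA : FA (1%g \oplus iotaA).
Proof. by exists 1%g. Qed.

End FA.

Arguments FA {d A n} hn.

(* Main.v *)
(** Send [x] to the pair [(n x, n (\sim x))] of elements of [L = L_A].  The
    Nelson inequality makes this map an order embedding and forces the second
    component of a product to be the one of the twist product, so the image [S]
    is closed under the twist operations.

    Since [rneg] is involutive on [L], [rneg \bot = 1].  The image contains
    [(a, a \to i)] and [(b \to i, b)] for all [a, b] in [L], and
    multiplying [(x, y)] in [S] by [(c, c \to i)] gives [(c x, c \to y)]; taking
    [c = rneg x] yields [(\bot, x \oplus y)].  Hence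
    [F_A = {e | (\bot, e) \in S}], from which the filter properties follow.
    If [a b <= i] and [(\bot, a \oplus b) \in S], then [(a, b)] is obtained as
    [(((rneg a, rneg a \to i) \to (\bot, a \oplus b)) `|` (a, a \to i))
      `&` (b \to i, b)]. *)

Require Import Defs.
From mathcomp Require Import all_boot all_order.
From mathcomp Require Import boolp classical_sets.

Set Implicit Arguments.
Unset Strict Implicit.
Unset Printing Implicit Defensive.

Import Order.Theory.
Local Open Scope group_scope.
Local Open Scope order_scope.

Section Residuation.
Variables (d : Order.disp_t) (A : crlType d).
Implicit Types x y z : A.

Lemma le_eqP x y : (forall w, (w <= x) = (w <= y)) -> x = y.
Proof. by move=> H; apply/le_anti; rewrite -H lexx H lexx. Qed.

Lemma rimp1x x : 1%g \to x = x.
Proof. by apply: le_eqP => w; rewrite -rimpP mul1g. Qed.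

Lemma le_rimpC x y z : (x <= y \to z) = (y <= x \to z).
Proof. by rewrite -!rimpP crl_mulC. Qed.

End Residuation.

Section Involution.
Variables (d : Order.disp_t) (A : cirlType d).
Implicit Types x y z : A.

(** [\sim 1%g] is dualizing, so facts about [\sim] reduce to residuation. *)
Lemma simE x : \sim x = x \to \sim 1%g.
Proof. by rewrite rimp_simC rimp1x. Qed.

Lemma mul_sim x : (x * \sim x)%g <= \sim 1%g.
Proof. by rewrite simE mul_rimp. Qed.

Lemma sim_mul x y : \sim (x * y)%g = x \to \sim y.
Proof. by rewrite simE rimpM -simE. Qed.

Lemma rimpE x y : x \to y = \sim (x * \sim y)%g.
Proof. by rewrite sim_mul simK. Qed.

Lemma le_sim x y : (x <= \sim y) = (y <= \sim x).
Proof. by rewrite (simE y) (simE x) le_rimpC. Qed.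

Lemma le_mul_sim x y : (x <= y) = ((x * \sim y)%g <= \sim 1%g).
Proof. by rewrite rimpP' -simE simK. Qed.

Lemma sim_join x y : \sim (x `|` y) = \sim x `&` \sim y.
Proof. by apply: le_eqP => w; rewrite lexI le_sim leUx !(le_sim w). Qed.

Lemma sim_meet x y : \sim (x `&` y) = \sim x `|` \sim y.
Proof. by rewrite -[RHS]simK sim_join !simK. Qed.

End Involution.

Section BotInvolutive.
Variables (d : Order.disp_t) (L : dncrlType d).
Implicit Types a b : L.

Lemma rneg1 : rneg 1%g = \bot :> L.
Proof. exact: rimp1x. Qed.

Lemma rneg0 : rneg \bot = 1%g :> L.
Proof. by rewrite -rneg1 rnegK. Qed.

Lemma oplus0x a : \bot \oplus a = a.
Proof. by rewrite /oplus rneg0 rimp1x. Qed.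

Lemma rneg_mul a : (rneg a * a)%g = \bot.
Proof. by apply/le_anti; rewrite le0x andbT crl_mulC mul_rimp. Qed.

End BotInvolutive.

Section TwistRepresentation.
Variables (d : Order.disp_t) (A : bcirlType d) (n : A -> A) (hn : inca n).
Local Notation L := (conucleus_image hn).
Local Notation p := (im_of hn).
Local Notation i := (iotaA hn).
Implicit Types (x y z : A) (a b c e : L).

Lemma im_of_val a : p (val a) = a.
Proof. by apply: val_inj; rewrite im_ofE im_fix. Qed.

(** [p] is right adjoint to the inclusion [val], hence preserves meets. *)
Lemma im_of_adj a x : (a <= p x) = (val a <= x).
Proof. by rewrite im_leE im_ofE im_le_of. Qed.

Lemma im_of_mul x y : p (x * y)%g = (p x * p y)%g.
Proof. by apply: val_inj; rewrite im_ofE (ncn_mul hn). Qed.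

Lemma im_of_join x y : p (x `|` y) = p x `|` p y.
Proof. by apply: val_inj; rewrite im_ofE (ncn_join hn). Qed.

Lemma im_of_meet x y : p (x `&` y) = p x `&` p y.
Proof. by apply: le_eqP => a; rewrite lexI !im_of_adj lexI. Qed.

Lemma im_of_mono x y : x <= y -> p x <= p y.
Proof. exact: (ncn_mono hn). Qed.

(** So [val a] is sent to [(a, a \to i)], whose second component is the largest that [a * b <= i]
    allows. *)
Lemma im_of_sim_val a : p (\sim val a) = a \to i.
Proof.
by apply: le_eqP => b; rewrite -rimpP !im_of_adj simE -rimpP.
Qed.

Lemma im_of_mul_sim x : (p x * p (\sim x))%g <= i.
Proof. by rewrite -im_of_mul im_of_mono ?mul_sim. Qed.

Lemma im_of_sim_mul x y :
  p (\sim (x * y)%g) = (p x \to p (\sim y)) `&` (p y \to p (\sim x)).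
Proof.
apply: le_eqP => a; rewrite lexI -!rimpP; apply/idP/andP => [h|[hx hy]].
  have le_xy u v : \sim (x * y)%g = u \to v -> (p u * a)%g <= p v.
    move=> E; rewrite (le_trans (crl_mulS _ h)) // -im_of_mul im_of_mono //.
    by rewrite E mul_rimp.
  by split; apply: le_xy; rewrite sim_mul // rimp_simC.
(* The Nelson inequality splits [x * y] into [n x * y] and [x * n y]; [hx] bounds the first case by
   [y * \sim y], [hy] the second by [x * \sim x]. *)
rewrite im_of_adj simE -rimpP rimpP' (le_trans (ncn_nelson hn x y)) // leUx.
have le_sim1 (u : L) v : val u <= n (\sim v) -> (v * val u)%g <= \sim 1%g.
  move=> /le_trans /(_ (ncn_le hn _)) /(crl_mulS v) /le_trans; apply.
  exact: mul_sim.
rewrite -!rimpP' -!mulgA crl_mulCA; apply/andP; split.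
  exact: (le_sim1 (p x * a)%g).
exact: (le_sim1 (p y * a)%g).
Qed.

Lemma im_of_rimp x y :
  p (x \to y) = (p x \to p y) `&` (p (\sim y) \to p (\sim x)).
Proof. by rewrite rimpE im_of_sim_mul simK. Qed.

Lemma im_of_sim_rimp x y : p (\sim (x \to y)) = (p x * p (\sim y))%g.
Proof. by rewrite rimpE simK im_of_mul. Qed.

Lemma im_of_sim_join x y : p (\sim (x `|` y)) = p (\sim x) `&` p (\sim y).
Proof. by rewrite sim_join im_of_meet. Qed.

Lemma im_of_sim_meet x y : p (\sim (x `&` y)) = p (\sim x) `|` p (\sim y).
Proof. by rewrite sim_meet im_of_join. Qed.

(** The Nelson inequality for [x * \sim y] leaves two terms, which the hypotheses put below
    [y * \sim y] and [x * \sim x]. *)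
Lemma le_im_of x y : p x <= p y -> p (\sim y) <= p (\sim x) -> x <= y.
Proof.
rewrite !im_leE !im_ofE => xy yx.
rewrite le_mul_sim (le_trans (ncn_nelson hn _ _)) // leUx; apply/andP; split.
  rewrite (le_trans (crl_mulSl _ (le_trans xy (ncn_le hn y)))) //.
  exact: mul_sim.
rewrite (le_trans (crl_mulS _ (le_trans yx (ncn_le hn _)))) //.
exact: mul_sim.
Qed.

Lemma FAP e : FA hn e <-> exists2 z, p z = \bot & p (\sim z) = e.
Proof.
split=> [[x _ <-]|[z z0 <-]]; last by exists z => //; rewrite z0 oplus0x.
exists (val (rneg (p x)) * x)%g; first by rewrite im_of_mul im_of_val rneg_mul.
rewrite im_of_sim_mul im_of_val im_of_sim_val; apply/meet_idPl.
(* The other term is [rneg (p x) \to (p x \to i)], and [p (\sim x) <= p x \to i]. *)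
rewrite rimp_rimpC; apply: rimpS; rewrite -rimpP; exact: im_of_mul_sim.
Qed.

Lemma FA_filter : lattice_filter (FA hn).
Proof.
split.
- by exists (1%g \oplus i); apply: one_oplus_iotaA.
- move=> e e' /FAP[z z0 <-] le_ee'; apply/FAP.
  (* The meet keeps the first component [\bot] and joins [e'] to the second. *)
  exists (z `&` \sim val e').
    by rewrite im_of_meet z0 meet0x.
  by rewrite im_of_sim_meet simK im_of_val; apply/join_idPr.
- move=> e e' /FAP[z z0 <-] /FAP[z' z0' <-]; apply/FAP.
  exists (z `|` z'); last by rewrite im_of_sim_join.
  by rewrite im_of_join z0 z0' joinxx.
Qed.

Lemma twist_set_im_of x : twist_set i (FA hn) (p x, p (\sim x)).
Proof. by split; [exact: im_of_mul_sim | exists x]. Qed.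

Lemma im_of_surj a b : twist_set i (FA hn) (a, b) ->
  exists2 x, p x = a & p (\sim x) = b.
Proof.
case=> /= ab_i /FAP[z z0 zab].
exists (((val (rneg a) \to z) `|` val a) `&` \sim val b).
  (* The implication contributes [a] met with another term; joining [a] absorbs that term, and
     [a <= b \to i] makes the last meet harmless. *)
  rewrite im_of_meet im_of_join im_of_rimp z0 !im_of_val !im_of_sim_val.
  rewrite -/(rneg _) rnegK meetUKC; apply/meet_idPl.
  by rewrite le_rimpC -rimpP.
(* The implication contributes [rneg a * (a \oplus b)], which is below [b] by modus ponens. *)
rewrite im_of_sim_meet im_of_sim_join im_of_sim_rimp simK !im_of_val zab.
apply/join_idPr; rewrite leIxl //; exact: mul_rimp.
Qed.

End TwistRepresentation.

Theorem theorem43 (d : Order.disp_t) (A : bcirlType d) (n : A -> A)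
    (hn : inca n) :
  exists hF : lattice_filter (FA hn),
    cirl_isomorphic A
      (twist (conucleus_image hn) (iotaA hn) (FA hn) hF (one_oplus_iotaA hn)).
Proof.
exists (FA_filter hn).
pose f x := tw_pair (FA_filter hn) (one_oplus_iotaA hn) (twist_set_im_of hn x).
have f_inj : injective f.
  move=> x y /(congr1 val) [xy yx].
  by apply/le_anti; rewrite !(@le_im_of _ _ _ hn) // im_leE !im_ofE ?xy ?yx.
have f_surj q : exists x, f x = q.
  have [x xE sxE] := im_of_surj (twP q).
  by exists x; apply: tw_inj.
exists f; split.
- have [g gK] := choice f_surj.
  by exists g => // x; apply: f_inj; rewrite gK.
- by move=> x y; apply: tw_inj; [exact: im_of_meet | exact: im_of_sim_meet].
- by move=> x y; apply: tw_inj; [exact: im_of_join | exact: im_of_sim_join].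
- by move=> x y; apply: tw_inj; [exact: im_of_mul | exact: im_of_sim_mul].
- by move=> x y; apply: tw_inj; [exact: im_of_rimp | exact: im_of_sim_rimp].
- by move=> x; apply: tw_inj; rewrite //= simK.
- exact: tw_inj.
Qed.
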